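(* Let $p$ be a prime, $s\geq 3$, let $K$ be one of $\mathbb Z$, $\mathbb Z_p$ (the $p$-adic integers) or $\mathbb Z_{(p)}$ (the localization of $\mathbb Z$ at $p$), and let $F$ be a field containing $K$. Let $G=C_{p^s}$ be the cyclic group of order $p^s$. Then the set of $K$-ranks $\operatorname{rank}_K M$ of indecomposable faithful $KC_{p^s}$-lattices $M$ for which there exists a $1$-cocycle $T:C_{p^s}\to \widehat M$ such that the group $\mathrm{Crys}(C_{p^s};M;T)$ is torsion-free is unbounded.
   Context: Standing conventions: $K$ is a commutative ring (here $\mathbb Z$, $\mathbb Z_p$ or $\mathbb Z_{(p)}$), $F$ a field containing $K$, $G$ a finite abelian group, and $M$ a $KG$-module that is free of finite rank over $K$ (a $KG$-lattice); $M$ is faithful if $G$ acts faithfully. Put $FM=F\otimes_K M$ (an $FG$-module containing $M$ as a full lattice) and $\widehat M=FM/M$ (quotient of additive groups), a $KG$-module via $g(x+M)=gx+M$. A $1$-cocycle is a map $T:G\to\widehat M$ with $T(gh)=gT(h)+T(g)$ for all $g,h\in G$; for cyclic $G=\langle a\rangle$ it is determined by $T(a)$ via $T(a^k)=(1+a+\dots+a^{k-1})T(a)$. $T$ is cohomologous to zero (a coboundary) if there is $x\in FM$ with $T(g)=(g-1)x+M$ for all $g\in G$; it is cohomologous to zero at an element $g$ if such $x$ exists for that $g$. Define $\mathrm{Crys}(G;M;T)=\{(g,x): g\in G,\ x\in FM,\ x+M=T(g)\}$ with multiplication $(g,x)(g',x')=(gg',\,g'x+x')$. A group is torsion-free if it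 has no nontrivial elements of finite order. *)

(* Defs.v *)
From HB Require Import structures.
From mathcomp Require Import all_boot all_order all_algebra.
Set Implicit Arguments. Unset Strict Implicit. Unset Printing Implicit Defensive.
Import Order.TTheory GRing.Theory Num.Theory.
Local Open Scope ring_scope.

Section Defs.
Variable F : fieldType.

Definition pmulK (K : F -> Prop) (p n : nat) (x : F) : Prop :=
  exists y, K y /\ x = ((p ^ n)%N)%:R * y.

Definition is_Z_in (K : F -> Prop) : Prop :=
  injective (fun z : int => z%:~R : F) /\
  forall x, K x <-> exists z : int, x = z%:~R.

Definition is_Zloc_in (p : nat) (K : F -> Prop) : Prop :=
  injective (fun z : int => z%:~R : F) /\
  forall x, K x <-> exists a b : int, ~~ (p%:Z %| b)%Z /\ x * b%:~R = a%:~R.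

(* K = Z_p, the p-adic integers = lim Z/p^n Z, as a subring of F:
   K/p^nK = Z/p^nZ via Z -> K, K is p-adically separated and complete. *)
Definition is_Zp_in (p : nat) (K : F -> Prop) : Prop :=
  [/\ [/\ K 1, (forall x y, K x -> K y -> K (x - y)) &
      (forall x y, K x -> K y -> K (x * y))],
      (forall n x, K x -> exists z : int, pmulK K p n (x - z%:~R)),
      (forall n (z : int), pmulK K p n (z%:~R) -> ((p ^ n)%N%:Z %| z)%Z),
      (forall x, K x -> (forall n, pmulK K p n x) -> x = 0) &
      (forall u : nat -> F, (forall n, K (u n)) ->
         (forall n, pmulK K p n (u n.+1 - u n)) ->
         exists y, K y /\ forall n, pmulK K p n (y - u n))].

Definition std_coeff_ring (p : nat) (K : F -> Prop) : Prop :=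
  is_Z_in K \/ is_Zloc_in p K \/ is_Zp_in p K.

Variable n : nat.

Definition in_latt (K : F -> Prop) (v : 'cV[F]_n) : Prop :=
  forall i j, K (v i j).

Definition mxpow (A : 'M[F]_n) (k : nat) : 'M[F]_n := iter k (mulmx A) 1%:M.

(* The cyclic group C_q = <a>, q = p^s, elements a^k with k < q; the
   KC_q-lattice structure on K^n is given by the action A of a
   (an n x n matrix with entries in K and A^q = 1). *)
Definition KG_lattice (K : F -> Prop) (q : nat) (A : 'M[F]_n) : Prop :=
  (forall i j, K (A i j)) /\ mxpow A q = 1%:M.

Definition faithful (q : nat) (A : 'M[F]_n) : Prop :=
  forall k, (0 < k < q)%N -> mxpow A k <> 1%:M.

Definition submodule (K : F -> Prop) (A : 'M[F]_n) (U : 'cV[F]_n -> Prop) :=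
  [/\ forall v, U v -> in_latt K v, U 0,
      (forall u v, U u -> U v -> U (u + v)),
      (forall c v, K c -> U v -> U (c *: v)) &
      (forall v, U v -> U (A *m v))].

Definition indecomposable (K : F -> Prop) (A : 'M[F]_n) : Prop :=
  (0 < n)%N /\
  forall U V, submodule K A U -> submodule K A V ->
    (forall v, U v -> V v -> v = 0) ->
    (forall v, in_latt K v -> exists u w, [/\ U u, V w & v = u + w]) ->
    (forall u, U u -> u = 0) \/ (forall v, V v -> v = 0).

Definition congM (K : F -> Prop) (x y : 'cV[F]_n) := in_latt K (x - y).

(* A 1-cocycle T : C_q -> FM/M, given by representatives T k of T(a^k). *)
Definition cocycle (K : F -> Prop) (q : nat) (A : 'M[F]_n)
  (T : nat -> 'cV[F]_n) : Prop :=
  forall k l, (k < q)%N -> (l < q)%N ->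
    congM K (T ((k + l) %% q)%N) (mxpow A k *m T l + T k).

Definition in_crys (K : F -> Prop) (q : nat) (T : nat -> 'cV[F]_n)
  (e : nat * 'cV[F]_n) : Prop := (e.1 < q)%N /\ congM K e.2 (T e.1).

Definition crys_mul (q : nat) (A : 'M[F]_n) (e f : nat * 'cV[F]_n) :=
  (((e.1 + f.1) %% q)%N, mxpow A f.1 *m e.2 + f.2).

Definition crys_pow (q : nat) (A : 'M[F]_n) (e : nat * 'cV[F]_n) (m : nat) :=
  iter m (fun z => crys_mul q A z e) (0%N, 0).

Definition crys_torsion_free (K : F -> Prop) (q : nat) (A : 'M[F]_n)
  (T : nat -> 'cV[F]_n) : Prop :=
  forall e, in_crys K q T e ->
    forall m, (0 < m)%N -> crys_pow q A e m = (0%N, 0) -> e = (0%N, 0).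

End Defs.

(* Main.v *)
Require Import Defs.
From HB Require Import structures.
From mathcomp Require Import all_boot all_order all_algebra zify ring.
From mathcomp Require Import boolp.
Set Implicit Arguments. Unset Strict Implicit. Unset Printing Implicit Defensive.
Import Order.TTheory GRing.Theory Num.Theory.
Local Open Scope ring_scope.

(* Let q = p^s and X^q - 1 = f g with g = (X - 1) Phi_{p^2}, so that f is divisible
   by Phi_p and Phi_q (for s = 3, f = Phi_p Phi_{p^3}). Let M be the module over
   K[X], X acting as a generator of C_q, with generators v_i, e_i (i < n) and
   relations
     f v_i = 0,    g e_i = (X - 1)^(p-1) v_i + p v_{i-1}    (v_{-1} = 0),
   an extension of (K[X]/g)^n by (K[X]/f)^n. The ideal I = (p, (X - 1)^(p-1))
   satisfies f, g, I^2 <= (p, X - 1) I, and p, (X - 1)^(p-1) are independent in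
   I / (p, X - 1) I. Hence an endomorphism of M induces the same matrix over F_p on
   the classes of the v_i and of the e_i, and this matrix commutes with the nilpotent
   Jordan block; for an idempotent it is 0 or 1. An idempotent that is 0 modulo
   (p, X - 1) is 0, because X - 1 is nilpotent modulo p and K is p-adically
   separated. So M is indecomposable.
   The vector w = Phi_{p^2} e_0 - (X - 1)^(p-2) v_0 is fixed by C_q, and w is not
   a norm from the subgroup of order p; the cocycle T(a^k) = (k/q) w then gives a
   torsion-free group. *)

(** * Cokernels of polynomial matrices as lattices *)


Section MonicDivision.
Variables (R : comNzRingType) (d : {poly R}) (dm : d \is monic).
Import Pdiv.CommonRing Pdiv.RingMonic.

Lemma rdivpD_monic u v : rdivp (u + v) d = rdivp u d + rdivp v d.
Proof.
rewrite {1}(rdivp_eq dm u) {1}(rdivp_eq dm v) addrACA -mulrDl.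
by rewrite rdivp_addl_mul_small // -rmodpD // ltn_rmodp monic_neq0.
Qed.

Lemma rdivpZ_monic c u : rdivp (c *: u) d = c *: rdivp u d.
Proof.
rewrite {1}(rdivp_eq dm u) scalerDr scalerAl.
by rewrite rdivp_addl_mul_small // -rmodpZ // ltn_rmodp monic_neq0.
Qed.

Lemma monic_mulIr (u v : {poly R}) : u * d = v * d -> u = v.
Proof. exact: (monic_rreg dm). Qed.

(** Division by the monic [d] is linear, so [m] times the remainder of [u] is the remainder of
    [v * d], which is 0; then [m] cancels in each coefficient. *)
Lemma monic_dvd_natmul m (u v : {poly R}) : (forall x : R, x *+ m = 0 -> x = 0) ->
  u *+ m = v * d -> exists w, u = w * d.
Proof.
move=> mreg uv; exists (rdivp u d); rewrite {1}(rdivp_eq dm u).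
suff -> : rmodp u d = 0 by rewrite addr0.
apply/polyP=> i; rewrite coef0; apply: mreg.
rewrite -coefMn -scaler_nat -rmodpZ // scaler_nat uv rmodp_mull // coef0 //.
Qed.
End MonicDivision.

Section Cokernel.
Variables (R : comNzRingType) (n : nat) (f g : {poly R}).
Hypotheses (fm : f \is monic) (gm : g \is monic) (f_gt1 : (1 < size f)%N).
Variable xi : 'M[{poly R}]_n.
Import Pdiv.CommonRing Pdiv.RingMonic.

(** Dividing the second half by [g] and then the first half by [f] gives each class a unique reduced
    representative, whose coefficients serve as coordinates. So the cokernel is free over [R], and
    [dec] plays the quotient map. The bound [n <= N] is what makes the ranks unbounded. *)
Lemma cokernel_coordinates :
  exists (N : nat) (dec : 'rV[{poly R}]_(n + n) -> 'cV[R]_N),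
  [/\ (n <= N)%N,
      forall u v, dec (u + v) = dec u + dec v,
      forall c u, dec (c%:P *: u) = c *: dec u,
      forall v, exists u, v = dec u &
      forall u, dec u = 0 <-> exists c, u = c *m block_mx f%:M 0 (- xi) g%:M].
Proof.
(* The relations [g] e = [xi] v move the quotient [gam u] of the second half into the first half, as
   [gam u *m xi]. *)
pose gam (u : 'rV[{poly R}]_(n + n)) := map_mx (fun h => rdivp h g) (rsubmx u) : 'rV_n.
pose bet (u : 'rV[{poly R}]_(n + n)) := map_mx (fun h => rmodp h g) (rsubmx u) : 'rV_n.
pose alp (u : 'rV[{poly R}]_(n + n)) := 
  map_mx (fun h => rmodp h f) (lsubmx u + gam u *m xi) : 'rV_n.
pose df := (size f).-1; pose dg := (size g).-1.
have gamD u v : gam (u + v) = gam u + gam v.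
  by apply/rowP=> i; rewrite !mxE rdivpD_monic.
have gamZ c u : gam (c%:P *: u) = c%:P *: gam u.
  by apply/rowP=> i; rewrite !mxE !mul_polyC rdivpZ_monic.
have betD u v : bet (u + v) = bet u + bet v.
  by apply/rowP=> i; rewrite !mxE rmodpD.
have betZ c u : bet (c%:P *: u) = c%:P *: bet u.
  by apply/rowP=> i; rewrite !mxE !mul_polyC rmodpZ.
have alpE u i : alp u 0 i = rmodp ((lsubmx u + gam u *m xi) 0 i) f by rewrite mxE.
have betE u i : bet u 0 i = rmodp (rsubmx u 0 i) g by rewrite mxE.
have alpD u v : alp (u + v) = alp u + alp v.
  apply/rowP=> i; rewrite [RHS]mxE !alpE linearD gamD mulmxDl /= addrACA.
  by rewrite [X in rmodp X]mxE rmodpD.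
have alpZ c u : alp (c%:P *: u) = c%:P *: alp u.
  apply/rowP=> i; rewrite [RHS]mxE !alpE linearZ gamZ -scalemxAl -scalerDr.
  by rewrite [X in rmodp X]mxE !mul_polyC rmodpZ.
pose dec u : 'cV[R]_(n * df + n * dg) :=
  (row_mx (mxvec (\matrix_(i < n, j < df) (alp u 0 i)`_j))
          (mxvec (\matrix_(i < n, j < dg) (bet u 0 i)`_j)))^T.
have szf h : (size (rmodp h f) <= df)%N.
  by rewrite -ltnS prednK ?ltn_rmodp ?monic_neq0 // ltnW.
have szg h : (size (rmodp h g) <= dg)%N.
  by rewrite -ltnS prednK ?ltn_rmodp ?monic_neq0 // size_poly_gt0 monic_neq0.
exists (n * df + n * dg)%N, dec; split.
- apply: leq_trans (leq_addr _ _); apply: leq_pmulr.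
  by rewrite /df; case: (size f) f_gt1 => [|[]].
- move=> u v; rewrite /dec -linearD add_row_mx -!linearD; congr (row_mx _ _)^T.
    by congr mxvec; apply/matrixP=> i j; rewrite alpD !mxE coefD.
  by congr mxvec; apply/matrixP=> i j; rewrite betD !mxE coefD.
- move=> c u; rewrite /dec -linearZ /= scale_row_mx -!linearZ; congr (row_mx _ _)^T.
    by congr mxvec; apply/matrixP=> i j; rewrite alpZ !mxE mul_polyC coefZ.
  by congr mxvec; apply/matrixP=> i j; rewrite betZ !mxE mul_polyC coefZ.
- move=> v.
  pose a := vec_mx (lsubmx v^T) : 'M_(n, df).
  pose b := vec_mx (rsubmx v^T) : 'M_(n, dg).
  exists (row_mx (\row_i rVpoly (row i a)) (\row_i rVpoly (row i b))).
  set u := row_mx _ _.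
  have b_small i : (size (rVpoly (row i b)) < size g)%N.
    apply: leq_ltn_trans (size_poly _ _) _.
    by rewrite prednK // size_poly_gt0 monic_neq0.
  have a_small i : (size (rVpoly (row i a)) < size f)%N.
    apply: leq_ltn_trans (size_poly _ _) _.
    by rewrite prednK // size_poly_gt0 monic_neq0.
  have gam0 : gam u = 0.
    by apply/rowP=> i; rewrite mxE row_mxKr !mxE rdivp_small.
  rewrite /dec; apply: trmx_inj; rewrite trmxK -[LHS]hsubmxK.
  congr row_mx; rewrite -[LHS]vec_mxK; congr mxvec; apply/matrixP=> i j.
    rewrite [RHS]mxE alpE gam0 mul0mx addr0 row_mxKl [X in rmodp X]mxE.
    by rewrite rmodp_small // coef_rVpoly_ord [RHS]mxE.
  rewrite [RHS]mxE betE row_mxKr [X in rmodp X]mxE.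
  by rewrite rmodp_small // coef_rVpoly_ord [RHS]mxE.
move=> u.
have rel_mul (c : 'rV_(n + n)) : c *m block_mx f%:M 0 (- xi) g%:M =
    row_mx (f *: lsubmx c - rsubmx c *m xi) (g *: rsubmx c).
  rewrite -{1}[c]hsubmxK mul_row_block mulmx0 add0r mulmxN.
  by rewrite !mul_mx_scalar.
split.
  rewrite /dec => /(congr1 trmx); rewrite trmxK trmx0 => /esym.
  rewrite -[LHS]row_mx0 => /eq_row_mx [a0 b0].
  have {}a0 : alp u = 0.
    apply/rowP=> i; apply/polyP=> j; rewrite [in RHS]mxE coef0.
    have [lt_j|le_j] := ltnP j df; last first.
      by rewrite nth_default // alpE (leq_trans (szf _)).
    move/(congr1 vec_mx): a0; rewrite mxvecK linear0.
    by move/matrixP/(_ i (Ordinal lt_j)); rewrite !mxE.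
  have {}b0 : bet u = 0.
    apply/rowP=> i; apply/polyP=> j; rewrite [in RHS]mxE coef0.
    have [lt_j|le_j] := ltnP j dg; last first.
      by rewrite nth_default // betE (leq_trans (szg _)).
    move/(congr1 vec_mx): b0; rewrite mxvecK linear0.
    by move/matrixP/(_ i (Ordinal lt_j)); rewrite !mxE.
  exists (row_mx (map_mx (fun h => rdivp h f) (lsubmx u + gam u *m xi)) (gam u)).
  rewrite rel_mul row_mxKl row_mxKr -[LHS]hsubmxK; congr row_mx.
    apply: (canRL (addrK _)); apply/rowP=> i.
    move/rowP/(_ i): a0; rewrite alpE => a0.
    by rewrite [LHS](rdivp_eq fm) a0 !mxE addr0 mulrC.
  apply/rowP=> i; move/rowP/(_ i): b0; rewrite betE => b0.
  by rewrite [LHS](rdivp_eq gm) b0 !mxE addr0 mulrC.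
case=> c; rewrite rel_mul => uE.
have gamE : gam u = rsubmx c.
  by apply/rowP=> i; rewrite uE mxE row_mxKr mxE mulrC rdivp_mull.
have bet0 : bet u = 0.
  by apply/rowP=> i; rewrite uE mxE row_mxKr mxE mulrC rmodp_mull // mxE.
have alp0 : alp u = 0.
  apply/rowP=> i; rewrite /alp gamE uE row_mxKl subrK.
  by rewrite mxE [X in rmodp X]mxE mulrC rmodp_mull // mxE.
rewrite /dec alp0 bet0; apply: trmx_inj; rewrite trmxK trmx0 -[RHS]row_mx0.
congr row_mx; rewrite -[RHS](linear0 mxvec); congr mxvec; apply/matrixP=> i j;
  by rewrite !mxE coef0.
Qed.
End Cokernel.


Section CokernelOperator.
Variables (R : comNzRingType) (k N : nat).
Variables (dec : 'rV[{poly R}]_k -> 'cV[R]_N) (Theta : 'M[{poly R}]_k).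
Hypotheses (decD : forall u v, dec (u + v) = dec u + dec v)
           (decZ : forall c u, dec (c%:P *: u) = c *: dec u)
           (dec_surj : forall v, exists u, v = dec u)
           (dec_eq0 : forall u, dec u = 0 <-> exists c, u = c *m Theta).

Lemma dec0 : dec 0 = 0.
Proof. by apply: (addrI (dec 0)); rewrite -decD !addr0. Qed.

Lemma decB u v : dec (u - v) = dec u - dec v.
Proof.
by rewrite decD -[- v]scaleN1r -[-1](rmorphN1 (@polyC R)) decZ scaleN1r.
Qed.

Lemma dec_sum I (r : seq I) (F : I -> 'rV[{poly R}]_k) :
  dec (\sum_(i <- r) F i) = \sum_(i <- r) dec (F i).
Proof. exact: (big_morph dec decD dec0). Qed.

Lemma dec_eq u v : dec u = dec v <-> exists c, u = v + c *m Theta.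
Proof.
split=> [uv | [c ->]]; last first.
  by rewrite decD (_ : dec (c *m Theta) = 0) ?addr0 //; apply/dec_eq0; exists c.
have /dec_eq0[c uvE] : dec (u - v) = 0 by rewrite decB uv subrr.
by exists c; rewrite -uvE addrC subrK.
Qed.

Lemma dec_rows (M : 'M[{poly R}]_k) :
  (forall i, dec (row i M) = 0) -> exists C, M = C *m Theta.
Proof.
move=> M0; have /fin_all_exists[c cP] i : exists c, row i M = c *m Theta.
  by apply/dec_eq0.
by exists (\matrix_i c i); apply/row_matrixP=> i; rewrite row_mul rowK.
Qed.

(** The kernel of [dec] is the row space of [Theta], a submodule over the polynomials, so
    multiplication by X descends to the coordinates. *)
Lemma dec_operator : exists A : 'M[R]_N, forall u, dec ('X *: u) = A *m dec u.
Proof.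
have /fin_all_exists[e eP] (j : 'I_N) : exists u, delta_mx j 0 = dec u.
  exact: dec_surj.
exists (\matrix_(i, j) dec ('X *: e j) i 0) => u.
pose u' := \sum_j (dec u j 0)%:P *: e j.
have dec_u' : dec u' = dec u.
  rewrite dec_sum [RHS]matrix_sum_delta; apply: eq_bigr => j _.
  by rewrite big_ord1 decZ -eP.
have -> : dec ('X *: u) = dec ('X *: u').
  have /dec_eq[c ->] := esym dec_u'; apply/dec_eq; exists ('X *: c).
  by rewrite scalerDr scalemxAl.
rewrite scaler_sumr dec_sum; apply/colP=> i; rewrite summxE mxE.
apply: eq_bigr => j _; rewrite scalerA mulrC -scalerA decZ !mxE mulrC //.
Qed.

Variable A : 'M[R]_N.
Hypothesis decX : forall u, dec ('X *: u) = A *m dec u.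

Lemma decXn j u : dec ('X^j *: u) = (A ^+ j) *m dec u.
Proof.
elim: j => [|j IH]; first by rewrite !expr0 scale1r mul1mx.
by rewrite !exprS -scalerA decX IH mulmxA.
Qed.

Lemma dec_intertwine (P : 'M[R]_N) (h : {poly R}) u v : P * A = A * P ->
  P *m dec u = dec v -> P *m dec (h *: u) = dec (h *: v).
Proof.
move=> PA Puv; elim/poly_ind: h => [|h c IH]; first by rewrite !scale0r dec0 mulmx0.
rewrite !scalerDl !decD mulmxDr !decZ -scalemxAr Puv; congr (_ + _).
rewrite ![h * 'X]mulrC -!scalerA !decX -IH !mulmxA; congr (_ *m _); exact: PA.
Qed.

(** Lifting the images of the generators gives [Om]. As [P] commutes with the action of X, it is
    linear over the polynomials, so [Om] induces [P] and must send relations to relations; [C]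
    records this. *)
Lemma dec_lift (P : 'M[R]_N) : P * A = A * P ->
  exists Om, (forall u, P *m dec u = dec (u *m Om)) /\
             exists C, Theta *m Om = C *m Theta.
Proof.
move=> PA.
have /fin_all_exists[w wP] (i : 'I_k) : exists w, P *m dec (delta_mx 0 i) = dec w.
  exact: dec_surj.
exists (\matrix_i w i).
have lift u : P *m dec u = dec (u *m \matrix_i w i).
  rewrite {1}[u]row_sum_delta dec_sum mulmx_sumr mulmx_sum_row dec_sum.
  by apply: eq_bigr => i _; rewrite rowK; apply: dec_intertwine.
split=> //; apply: dec_rows => i.
rewrite row_mul -lift (_ : dec _ = 0) ?mulmx0 //.
by apply/dec_eq0; exists (delta_mx 0 i); rewrite rowE.
Qed.
End CokernelOperator.

(** * Reduction modulo (p, X - 1) and idempotents that vanish there *)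

Section Residue.
Variables (R : comNzRingType) (p : nat) (rho : {rmorphism R -> 'F_p}).
Hypothesis p_pr : prime p.
Hypothesis rho_ker : forall x, rho x = 0 -> exists y, x = p%:R * y.

Lemma rho_nat_p : rho p%:R = 0.
Proof. by rewrite rmorph_nat; apply/eqP; rewrite -(dvdn_pcharf (pchar_Fp p_pr)). Qed.

Lemma poly_reduction_ker (h : {poly R}) :
  map_poly rho h = 0 -> exists h', h = p%:R *: h'.
Proof.
move=> h0.
have /choice[c cP] i : exists y, h`_i = p%:R * y.
  by apply: rho_ker; rewrite -coef_map h0 coef0.
exists (\poly_(i < size h) c i); apply/polyP=> i.
rewrite coefZ coef_poly; case: ltnP => [_|le]; first exact: cP.
by rewrite mulr0 nth_default.
Qed.

Lemma poly_residue_ker (h : {poly R}) : rho h.[1] = 0 ->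
  exists a b, h = p%:R *: a + ('X - 1) * b.
Proof.
move=> /rho_ker[y hE].
have /factor_theorem[b bE] : root (h - h.[1]%:P) 1 by rewrite rootE !hornerE subrr.
exists y%:P, b; rewrite mulrC -polyC1 -bE -mul_polyC -polyCM -hE addrC subrK //.
Qed.
End Residue.

Section NilpotentIdempotent.
Variables (R : comNzRingType) (p q N : nat) (A P : 'M[R]_N).
Hypothesis separated : forall x : R, (forall k, exists y, x = (p ^ k)%:R * y) -> x = 0.
Hypotheses (PA : P * A = A * P) (PP : P * P = P).
Hypothesis A_nilp : forall v : 'cV[R]_N, exists b, (A - 1) ^+ q *m v = p%:R *: b.
Hypothesis P_small : forall v : 'cV[R]_N, exists b c,
  P *m v = p%:R *: b + (A - 1) *m c.

Lemma nilpotent_idempotent : P = 0.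
Proof.
have PPv (v : 'cV_N) : P *m (P *m v) = P *m v by rewrite mulmxA [P *m P]PP.
have PAk j : P * (A - 1) ^+ j = (A - 1) ^+ j * P.
  apply: commrX; rewrite /GRing.comm mulrBr mulrBl mulr1 mul1r PA //.
(* Since P = P^2 commutes with A - 1, applying [P] once more to an expression of P v gains one
   factor A - 1. In [step3] the same device gains powers of p. *)
have step1 j (v : 'cV_N) : exists b c : 'cV_N, P *m v = p%:R *: b + (A - 1) ^+ j *m c.
  elim: j => [|j [b [c vE]]]; first by exists 0, (P *m v); rewrite scaler0 add0r expr0 mul1mx.
  have [b' [c' cE]] := P_small c.
  exists (P *m b + (A - 1) ^+ j *m b'), c'.
  rewrite -PPv vE mulmxDr -scalemxAr mulmxA [P *m _]PAk -mulmxA cE mulmxDr.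
  by rewrite scalerDr -scalemxAr addrA exprSr mulmxA.
have step2 (v : 'cV_N) : exists b, P *m v = p%:R *: b.
  have [b [c ->]] := step1 q v; have [b' ->] := A_nilp c.
  by exists (b + b'); rewrite scalerDr.
have step3 j (v : 'cV_N) : exists b, P *m v = (p ^ j)%:R *: b.
  elim: j => [|j [b vE]]; first by exists (P *m v); rewrite scale1r.
  have [b' bE] := step2 b; exists b'.
  by rewrite -PPv vE -scalemxAr bE scalerA -natrM expnSr.
apply/matrixP=> i j; rewrite [RHS]mxE; apply: separated => m.
have [b /colP/(_ i)] := step3 m (delta_mx j 0).
by rewrite -colE !mxE => ->; exists (b i 0).
Qed.
End NilpotentIdempotent.

(** * Idempotents commuting with a Jordan block *)


Section JordanBlock.
Variable n : nat.

(** The ones lie below the diagonal: row i stands for v_(i-1), and row 0 vanishes in accordance with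
    v_(-1) = 0. *)
Definition jordan (S : pzRingType) : 'M[S]_n := \matrix_(i, j) (i == j.+1 :> nat)%:R.

Lemma map_jordan (S S' : pzRingType) (h : {rmorphism S -> S'}) :
  map_mx h (jordan S) = jordan S'.
Proof. by apply/matrixP=> i j; rewrite !mxE rmorph_nat. Qed.

Variable k : fieldType.
Implicit Type M : 'M[k]_n.

Lemma idem_strict_lower_eq0 M : M *m M = M ->
  (forall i j : 'I_n, (i <= j)%N -> M i j = 0) -> M = 0.
Proof.
move=> MM M0.
(* Induction over subdiagonals: in the sum for (M M) i j, the terms with l >= i vanish by
   assumption, and those with l < i lie on an earlier subdiagonal. *)
suff Md d (i j : 'I_n) : (i < j + d.+1)%N -> M i j = 0.
  by apply/matrixP=> i j; rewrite mxE (Md n) // addnS ltnS ltnW // ltn_addl.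
elim: d i j => [|d IH] i j; first by rewrite addn1 ltnS => /M0.
move=> lt_ij; rewrite -MM mxE big1 // => l _.
have [/M0->|lt_li] := leqP i l; first by rewrite mul0r.
by rewrite (IH l j) ?mulr0 //; move: lt_ij lt_li; rewrite !addnS; lia.
Qed.

End JordanBlock.

(** Commuting with the Jordan block makes M constant along diagonals and zero above the main one.
    The diagonal value is an idempotent of a field, so M or 1 - M is a strictly lower triangular
    idempotent. *)
Lemma idem_comm_jordan (k : fieldType) n (M : 'M[k]_n) :
  M *m M = M -> M *m jordan n k = jordan n k *m M -> M = 0 \/ M = 1%:M.
Proof.
case: n M => [|m] M MM MJ; first by left; apply/matrixP=> -[].
have MJE (i j : 'I_m.+1) (lt : (j.+1 < m.+1)%N) :
    M i (Ordinal lt) = if i is Ordinal i'.+1 lti then M (inord i') j else 0.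
  move/matrixP/(_ i j): MJ; rewrite !mxE (bigD1 (Ordinal lt)) //= !mxE eqxx mulr1.
  rewrite big1 => [|l /negPf nl]; last first.
    by rewrite mxE (_ : (l == _ :> nat) = false) ?mulr0 // -nl.
  rewrite addr0 => ->; case: i => [[|i'] lti].
    by rewrite big1 // => l _; rewrite mxE mul0r.
  have lt_i' : (i' < m.+1)%N by exact: ltnW.
  rewrite (bigD1 (inord i')) //= mxE inordK // eqxx mul1r big1 ?addr0 // => l nl.
  rewrite mxE (_ : (_ == _ :> nat) = false) ?mul0r //=.
  by apply: contraNF nl => /eqP[->]; rewrite inord_val.
have upper (j i : 'I_m.+1) : (i < j)%N -> M i j = 0.
  case: j => j; elim: j i => [|j IH] i ltj //= lt_ij.
  have ltj' : (j < m.+1)%N := ltnW ltj.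
  rewrite (_ : Ordinal ltj = @Ordinal m.+1 (Ordinal ltj').+1 ltj); last exact: val_inj.
  rewrite MJE; case: i lt_ij => [[|i'] lti] //= lt_ij.
  by apply: IH; rewrite inordK // ltnW.
have diag (i : 'I_m.+1) : M i i = M 0 0.
  case: i => i; elim: i => [|i IH] lti; first by congr (M _ _); apply: val_inj.
  have lti' : (i < m.+1)%N := ltnW lti.
  rewrite -[RHS](IH lti') {2}(_ : Ordinal lti = @Ordinal m.+1 (Ordinal lti').+1 lti);
    last exact: val_inj.
  by rewrite MJE; congr (M _ _); apply: val_inj; rewrite /= inordK.
have : M 0 0 * (M 0 0 - 1) = 0.
  apply/eqP; rewrite mulrBr mulr1 subr_eq0 -{3}MM mxE (bigD1 ord0) //= big1 ?addr0 //.
  by move=> l nl; rewrite (upper l) ?mul0r // lt0n.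
move/eqP; rewrite mulf_eq0 => /orP[/eqP M0|]; last rewrite subr_eq0 => /eqP M1.
  left; apply: idem_strict_lower_eq0 => // i j; rewrite leq_eqVlt => /orP[/eqP/val_inj<-|].
    by rewrite diag.
  exact: upper.
right; apply/eqP; rewrite eq_sym -subr_eq0; apply/eqP.
apply: idem_strict_lower_eq0 => [|i j].
  by rewrite mulmxBl mul1mx mulmxBr mulmx1 MM subrr subr0.
rewrite leq_eqVlt => /orP[/eqP/val_inj<-|lt].
  by rewrite !mxE eqxx diag M1 subrr.
by rewrite !mxE (upper j i) // -val_eqE /= ltn_eqF ?subr0.
Qed.

(** * The factors of X^q - 1 *)


Section Geometric.
Variable R : comNzRingType.

Lemma monic_Xn_sub1 d : (0 < d)%N -> ('X^d - 1 : {poly R}) \is monic.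
Proof. by move=> d0; rewrite -polyC1 monicXnsubC. Qed.

Definition geom (d m : nat) : {poly R} := \sum_(i < m) 'X^(d * i).

Lemma geomP d m : ('X^d - 1) * geom d m = 'X^(d * m) - 1.
Proof.
rewrite exprM [RHS]subrX1; congr (_ * _).
by apply: eq_bigr => i _; rewrite exprM.
Qed.

Lemma geom_at1 d m : (geom d m).[1] = m%:R.
Proof.
rewrite horner_sum (eq_bigr (fun=> 1)) ?sumr_const ?card_ord // => i _.
by rewrite hornerXn expr1n.
Qed.

Lemma geom_monic d m : (0 < d)%N -> (0 < m)%N -> geom d m \is monic.
Proof.
move=> d0 m0; rewrite -(monicMl _ (monic_Xn_sub1 d0)) geomP.
by rewrite monic_Xn_sub1 // muln_gt0 d0.
Qed.

Lemma size_geom d m : (0 < d)%N -> (0 < m)%N -> size (geom d m) = (d * m - d).+1.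
Proof.
move=> d0 m0; have := congr1 (fun h : {poly R} => size h) (geomP d m).
rewrite mulrC size_Mmonic ?monic_neq0 ?monic_Xn_sub1 ?geom_monic //.
rewrite !size_Xn_sub_1 ?muln_gt0 ?d0 // addnS /= => E.
by have := leq_pmulr d m0; lia.
Qed.

(* geom 1 p = Phi_p and geom p p = Phi_{p^2}. *)
Definition fpol p s : {poly R} := geom 1 p * geom (p ^ 2) (p ^ (s - 2)).
Definition gpol p : {poly R} := ('X - 1) * geom p p.

Lemma fgpol p s : (2 < s)%N -> fpol p s * gpol p = 'X^(p ^ s) - 1.
Proof.
move=> s3; rewrite /fpol /gpol.
transitivity (((('X^1 - 1) * geom 1 p) * geom p p) * geom (p ^ 2) (p ^ (s - 2))).
  by rewrite expr1; ring.
by rewrite geomP mul1n geomP mulnn geomP -expnD subnKC // ltnW.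
Qed.

Variables (p s : nat).
Hypotheses (p_pr : prime p) (s3 : (2 < s)%N).
Let p_gt0 : (0 < p)%N := prime_gt0 p_pr.

Lemma fpol_monic : fpol p s \is monic.
Proof. by rewrite monicMl ?geom_monic ?expn_gt0 ?p_gt0. Qed.

Lemma gpol_monic : gpol p \is monic.
Proof. by rewrite monicMl ?geom_monic // -polyC1 monicXsubC. Qed.

Lemma size_fpol : size (fpol p s) = (p ^ s - p ^ 2 + p)%N.
Proof.
rewrite size_Mmonic ?monic_neq0 ?geom_monic ?expn_gt0 ?p_gt0 //.
rewrite !size_geom ?expn_gt0 ?p_gt0 // -expnD subnKC ?(ltnW s3) //.
by rewrite mul1n; move: (p ^ s)%N (p ^ 2)%N p_gt0 => a b; lia.
Qed.

(** The left side is the size of X^(p^(s-1)) - 1, so [fpol] cannot divide that polynomial;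
    faithfulness follows from this. *)
Lemma size_fpol_gt : (p ^ (s - 1) + 1 < size (fpol p s))%N.
Proof.
rewrite size_fpol; have p2 := prime_gt1 p_pr.
have le2 : (p ^ 2 <= p ^ (s - 1))%N by rewrite leq_exp2l //; lia.
have -> : (p ^ s = p * p ^ (s - 1))%N by rewrite -expnS; congr expn; lia.
move: le2; move: (p ^ (s - 1))%N => t; rewrite expnS expn1; nia.
Qed.

(** The value p^(s-1) is written with a factor p^2 split off, which is possible because s >= 3.
    Divisibility by p^2 is what the comparison at X = 1 requires. *)
Lemma fpol_at1 : (fpol p s).[1] = (p ^ 2 * p ^ (s - 3))%N%:R.
Proof.
rewrite hornerM !geom_at1 -natrM -expnS -expnD; congr (_ ^ _)%:R; lia.
Qed.

Lemma gpol_at1 : (gpol p).[1] = 0.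
Proof. by rewrite hornerM !hornerE subrr mul0r. Qed.
End Geometric.

Lemma map_geom (R S : comNzRingType) (h : {rmorphism R -> S}) d m :
  map_poly h (geom R d m) = geom S d m.
Proof. by rewrite rmorph_sum; apply: eq_bigr => i _; rewrite /= map_polyXn. Qed.

(** * Cyclotomic factors modulo p *)

Section ModP.
Variables (p : nat) (p_pr : prime p).
Let p_gt0 : (0 < p)%N := prime_gt0 p_pr.
Notation lam := ('X - 1 : {poly 'F_p}).

Lemma lam_monic : lam \is monic.
Proof. by rewrite -polyC1 monicXsubC. Qed.

Lemma frobenius_sub1 (u : {poly 'F_p}) k : (u - 1) ^+ (p ^ k) = u ^+ (p ^ k) - 1.
Proof.
have nat_p : [pchar {poly 'F_p}].-nat (p ^ k)%N.
  rewrite pnatX; apply/orP; left.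
  by rewrite (eq_pnat _ (pchar_poly _)) pnatE ?pchar_Fp.
by rewrite exprDn_pchar // exprNn_pchar // expr1n.
Qed.

(** By Frobenius X^(p^j k) - 1 = (X^k - 1)^(p^j) modulo p, and the monic factor X^(p^a k) - 1
    cancels. *)
Lemma geom_modp a b k : (0 < k)%N ->
  geom 'F_p (p ^ a * k) (p ^ b) = ('X^k - 1) ^+ (p ^ (a + b) - p ^ a).
Proof.
move=> k0; have le_ab : (p ^ a <= p ^ (a + b))%N by rewrite leq_pexp2l ?leq_addr.
have d0 : (0 < p ^ a * k)%N by rewrite muln_gt0 expn_gt0 p_gt0.
apply: (monic_mulIr (monic_Xn_sub1 _ d0)).
have E m : ('X^(p ^ m * k) - 1 : {poly 'F_p}) = ('X^k - 1) ^+ (p ^ m).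
  by rewrite frobenius_sub1 -exprM mulnC.
by rewrite mulrC geomP mulnAC -expnD !E -exprD subnK.
Qed.
End ModP.

(** * The extension lattice *)


(** X^q - 1 is separable up to q, so the ideal (f, g) contains q and q a is a multiple of g; then q
    cancels because g is monic. For modules: there is no nonzero map from R[X]/f to R[X]/g. *)
Lemma monic_separable_dvd (R : comNzRingType) (q : nat) (f g a b : {poly R}) :
    (0 < q)%N -> (forall x : R, x *+ q = 0 -> x = 0) -> g \is monic ->
  f * g = 'X^q - 1 -> f * a = g * b -> exists c, a = g * c.
Proof.
move=> q0 qreg gm fg fagb.
(* q = X (f g)' - q (f g) *)
have bezout : f * ('X * g^`() - g *+ q) + g * ('X * f^`()) = q%:R.
  transitivity ('X * (f * g)^`() - (f * g) *+ q); first by rewrite derivM; ring.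
  rewrite fg derivB derivXn -polyC1 derivC subr0 mulrnAr -exprS prednK //.
  by rewrite mulrnBl opprB addrC subrK.
have [c ->] : exists c, a = c * g; last by exists c; rewrite mulrC.
apply: (@monic_dvd_natmul _ _ gm q _ (b * ('X * g^`() - g *+ q) + a * ('X * f^`()))) => //.
rewrite -mulr_natl -bezout mulrDl mulrAC fagb; ring.
Qed.

Section OverR.
Variables (R : comNzRingType) (p s m : nat) (rho : {rmorphism R -> 'F_p}).
Hypotheses (p_pr : prime p) (s3 : (2 < s)%N).
Hypothesis rho_ker : forall x, rho x = 0 -> exists y, x = p%:R * y.
Hypothesis natreg : forall k (x : R), (0 < k)%N -> x *+ k = 0 -> x = 0.
Hypothesis separated : forall x : R, (forall k, exists y, x = (p ^ k)%:R * y) -> x = 0.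
Let p_gt0 : (0 < p)%N := prime_gt0 p_pr.
Let p_gt1 : (1 < p)%N := prime_gt1 p_pr.
Notation n := m.+1.
Notation lam := ('X - 1 : {poly R}).
Notation f := (fpol R p s).
Notation g := (gpol R p).
Notation q := (p ^ s)%N.
Notation red := (map_poly rho).
Notation lamp := ('X - 1 : {poly 'F_p}).

(** The two summands are detected separately: modulo p only the scalar part survives, and at X = 1
    only p times the Jordan block. *)
Definition ext_class : 'M[{poly R}]_n := (lam ^+ p.-1)%:M + p%:R *: jordan n {poly R}.
(* The columns correspond to the generators v_0, ..., v_m, e_0, ..., e_m and the
   rows to the relations. *)
Definition presentation : 'M[{poly R}]_(n + n) := block_mx f%:M 0 (- ext_class) g%:M.

Definition residue : {poly R} -> 'F_p := rho \o horner_eval 1.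
HB.instance Definition _ := GRing.RMorphism.on residue.

Lemma residue_red h : residue h = (red h).[1].
Proof. by rewrite /residue /= horner_evalE -(rmorph1 rho) horner_map. Qed.

Lemma red_lam : red lam = lamp.
Proof. by rewrite rmorphB rmorph1 /= map_polyX. Qed.

Lemma red_f : red f = lamp ^+ (q - p ^ 2 + p.-1).
Proof.
rewrite rmorphM /= !map_geom.
have -> : geom 'F_p 1 p = lamp ^+ p.-1.
  by have := geom_modp p_pr 0 1 (ltn0Sn 0); rewrite !expn0 expn1 subn1.
have -> : geom 'F_p (p ^ 2) (p ^ (s - 2)) = lamp ^+ (q - p ^ 2).
  by have := geom_modp p_pr 2 (s - 2) (ltn0Sn 0); rewrite muln1 subnKC // ltnW.
by rewrite -exprD addnC.
Qed.

Lemma red_geomp : red (geom R p p) = lamp ^+ (p ^ 2 - p).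
Proof.
rewrite map_geom; have := geom_modp p_pr 1 1 (ltn0Sn 0).
by rewrite expn1 muln1.
Qed.

Lemma red_g : red g = lamp ^+ (p ^ 2 - p).+1.
Proof. by rewrite rmorphM /= red_lam red_geomp exprS. Qed.

Lemma lamp_cancel k (u v : {poly 'F_p}) : lamp ^+ k * u = lamp ^+ k.+1 * v -> u.[1] = 0.
Proof.
rewrite ![lamp ^+ _ * _]mulrC exprSr mulrA mulrAC.
move/(monic_mulIr (monic_exp _ (lam_monic p)))->.
by rewrite hornerM !hornerE subrr mulr0.
Qed.

(** The exponent p is one more than the order [p.-1] of [ext_class] modulo p, so multiples of f, and
    likewise of g, drop out when coefficients of (X - 1)^(p-1) are compared. *)
Lemma red_f_dvd : exists f1, red f = lamp ^+ p * f1.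
Proof.
exists (lamp ^+ (q - p ^ 2).-1); rewrite red_f -exprD; congr (_ ^+ _).
have : (p ^ 2 < p ^ s)%N by rewrite ltn_exp2l.
by move: (p ^ s)%N (p ^ 2)%N p_gt0 => a b; lia.
Qed.

Lemma red_g_dvd : exists g1, red g = lamp ^+ p * g1.
Proof.
exists (lamp ^+ (p ^ 2 - p.*2).+1); rewrite red_g -exprD; congr (_ ^+ _).
by rewrite -!mulnn; nia.
Qed.

Lemma natreg_p (x : R) : p%:R * x = 0 -> x = 0.
Proof. by rewrite mulr_natl; apply: natreg. Qed.

(** The presentation is minimal: changing a lift by relations does not change its residue. Hence a
    lift of an idempotent has an idempotent residue. *)
Lemma residue_presentation : map_mx residue presentation = 0.
Proof.
have p0 : residue p%:R = 0 by rewrite rmorph_nat -(rmorph_nat rho) rho_nat_p.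
rewrite map_block_mx map_mxN map_mxD map_mxZ !map_scalar_mx map_mx0 /= p0 scale0r addr0.
have -> : residue (lam ^+ p.-1) = 0.
  rewrite rmorphXn /= /residue /= horner_evalE !hornerE subrr rmorph0.
  by rewrite expr0n eqn0Ngt -ltnS prednK // p_gt1.
have -> : residue g = 0 by rewrite /residue /= horner_evalE gpol_at1 rmorph0.
have -> : residue f = 0.
  rewrite /residue /= horner_evalE fpol_at1 // rmorph_nat natrM expnS natrM.
  by rewrite -(rmorph_nat rho p) rho_nat_p // !mul0r.
by rewrite !raddf0 block_mx0.
Qed.

(** Let Om have blocks phi, phi', chi, psi and write Xi for [ext_class]. The upper right block gives
    phi' = g ka, then the lower right one gives C4 = psi - Xi ka. The lower left block becomes the
    equation [E], which is read once modulo p and once at X = 1. *)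
Lemma residue_endomorphism Om C : presentation *m Om = C *m presentation ->
  let Om0 := map_mx residue Om in
  [/\ ursubmx Om0 = 0, ulsubmx Om0 = drsubmx Om0 &
      ulsubmx Om0 *m jordan n 'F_p = jordan n 'F_p *m ulsubmx Om0].
Proof.
rewrite -[Om]submxK -[C]submxK.
move: (ulsubmx Om) (ursubmx Om) (dlsubmx Om) (drsubmx Om) => phi phi' chi psi.
move: (ulsubmx C) (ursubmx C) (dlsubmx C) (drsubmx C) => C1 C2 C3 C4.
rewrite !mulmx_block !mul_scalar_mx !mul_mx_scalar !mul0mx !mulmx0 !addr0 !add0r.
case/eq_block_mx=> _ E2 E3 E4; cbv zeta.
rewrite map_block_mx block_mxKur block_mxKul block_mxKdr.
have [ka kaE] : exists ka, phi' = g *: ka.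
  have /choice[c cP] (ij : 'I_n * 'I_n) : exists c, phi' ij.1 ij.2 = g * c.
    move/matrixP/(_ ij.1 ij.2): E2; rewrite !mxE.
    apply: (@monic_separable_dvd _ q); rewrite ?expn_gt0 ?p_gt0 ?gpol_monic ?fgpol //.
    by move=> x; apply: natreg; rewrite expn_gt0 p_gt0.
  by exists (\matrix_(i, j) c (i, j)); apply/matrixP=> i j; rewrite !mxE -cP.
have C4E : C4 = psi - ext_class *m ka.
  apply/matrixP=> i j; apply: (monic_mulIr (gpol_monic R p_pr)).
  move/matrixP/(_ i j): E4; rewrite kaE mulNmx -scalemxAr => E4.
  rewrite ![_ * g]mulrC; move: E4; rewrite !mxE => <-; ring.
have E : ext_class *m phi - psi *m ext_class + ext_class *m ka *m ext_class
         = g *: chi - f *: C3.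
  move: E3; rewrite C4E mulNmx mulmxN mulmxBl => E3.
  rewrite -[g *: chi](addNKr (ext_class *m phi)) E3.
  by rewrite [f *: C3 + _]addrC addrA addrK opprB addrA addrAC.
(* Modulo p, Xi is (X - 1)^(p-1), while g chi, f C3 and Xi ka Xi are divisible by (X - 1)^p, the
   last because 2(p - 1) >= p. So the residue of phi - psi vanishes. *)
have phi_psi : map_mx residue phi = map_mx residue psi.
  have [f1 f1E] := red_f_dvd; have [g1 g1E] := red_g_dvd.
  have red_ext : map_mx red ext_class = (lamp ^+ p.-1)%:M.
    rewrite map_mxD map_mxZ map_scalar_mx rmorphXn /= red_lam rmorph_nat.
    by rewrite -(rmorph_nat (@polyC 'F_p)) -(rmorph_nat rho) rho_nat_p // scale0r addr0.
  have := congr1 (map_mx red) E.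
  rewrite map_mxD !map_mxB !map_mxM !map_mxZ /= red_ext f1E g1E.
  rewrite !mul_scalar_mx !mul_mx_scalar => redE.
  apply/matrixP=> i j; rewrite !mxE !residue_red; apply/eqP; rewrite -subr_eq0 -hornerN -hornerD.
  apply/eqP/(@lamp_cancel p.-1 _ (g1 * red (chi i j) - f1 * red (C3 i j) -
     lamp ^+ (p - 2) * red (ka i j))).
  have lampE : lamp ^+ p.-1 = lamp * lamp ^+ (p - 2).
    by rewrite -exprS; congr (_ ^+ _); lia.
  have := congr1 (fun M : 'M_n => M i j) redE; rewrite !mxE prednK //.
  have -> : lamp ^+ p = lamp ^+ p.-1 * lamp by rewrite -exprSr prednK.
  move: (lamp ^+ p.-1) (lamp ^+ (p - 2)) lampE => L l.
  move: (red (phi i j)) (red (psi i j)) (red (ka i j)) (red (chi i j)) (red (C3 i j)).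
  move=> x y z u v LE redE'.
  transitivity ((L * x - L * y + L * (L * z)) - L * (L * z)); first by ring.
  by rewrite redE' LE; ring.
have comm : jordan n 'F_p *m map_mx residue phi = map_mx residue psi *m jordan n 'F_p.
  pose ev := horner_eval (1 : R).
  have ev_ext : map_mx ev ext_class = p%:R *: jordan n R.
    rewrite map_mxD map_mxZ map_scalar_mx rmorphXn rmorph_nat map_jordan.
    rewrite /ev /= horner_evalE !hornerE subrr expr0n eqn0Ngt -ltnS prednK // p_gt1.
    by rewrite raddf0 add0r.
  have := congr1 (map_mx ev) E.
  rewrite map_mxD !map_mxB !map_mxM !map_mxZ /= ev_ext.
  have -> : horner_eval 1 g = 0 by exact: gpol_at1.
  have -> : horner_eval 1 f = (p ^ 2 * p ^ (s - 3))%N%:R by exact: fpol_at1.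
  rewrite scale0r sub0r.
  rewrite -!scalemxAl -!scalemxAr => evE.
  (* At X = 1 the polynomial g vanishes, Xi is p J, and both f C3 and Xi ka Xi are divisible by p^2.
     Cancelling one p leaves an error still divisible by p. *)
  have {}evE : jordan n R *m map_mx ev phi - map_mx ev psi *m jordan n R
     = - (p%:R *: ((p ^ (s - 3))%:R *: map_mx ev C3
                   + jordan n R *m map_mx ev ka *m jordan n R)).
    apply/eqP; rewrite -subr_eq0; apply/eqP/matrixP=> i j.
    rewrite [RHS]mxE; apply: natreg_p.
    have := congr1 (fun M : 'M_n => M i j) evE.
    set X := jordan n R *m map_mx ev phi; set Y := map_mx ev psi *m _.
    set Z := jordan n R *m map_mx ev ka *m _.
    rewrite !mxE natrM -mulnn natrM => /eqP; rewrite -subr_eq0 => /eqP evE'.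
    by rewrite -[RHS]evE' /ev; ring.
  have := congr1 (map_mx rho) evE.
  rewrite map_mxB !map_mxM map_mxN map_mxZ /= rho_nat_p // scale0r oppr0 -!map_mx_comp.
  by rewrite !map_jordan => /eqP; rewrite subr_eq0 => /eqP.
split; [|exact: phi_psi|by rewrite comm phi_psi].
have g0 : residue g = 0 by rewrite /residue /= horner_evalE gpol_at1 rmorph0.
by rewrite kaE map_mxZ /= g0 scale0r.
Qed.
End OverR.

(** * The action on the lattice: order, idempotents and the fixed vector *)

Section Lattice.
Variables (R : comNzRingType) (p s m : nat) (rho : {rmorphism R -> 'F_p}).
Hypotheses (p_pr : prime p) (s3 : (2 < s)%N).
Hypothesis rho_ker : forall x, rho x = 0 -> exists y, x = p%:R * y.
Hypothesis natreg : forall k (x : R), (0 < k)%N -> x *+ k = 0 -> x = 0.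
Hypothesis separated : forall x : R, (forall k, exists y, x = (p ^ k)%:R * y) -> x = 0.
Let p_gt0 : (0 < p)%N := prime_gt0 p_pr.
Let p_gt1 : (1 < p)%N := prime_gt1 p_pr.
Notation n := m.+1.
Notation lam := ('X - 1 : {poly R}).
Notation f := (fpol R p s).
Notation g := (gpol R p).
Notation q := (p ^ s)%N.
Notation Theta := (presentation R p s m).
Notation res := (map_mx (residue rho)).
Notation red := (map_poly rho).

Variables (N : nat) (dec : 'rV[{poly R}]_(n + n) -> 'cV[R]_N).
Hypotheses (decD : forall u v, dec (u + v) = dec u + dec v)
           (decZ : forall c u, dec (c%:P *: u) = c *: dec u)
           (dec_surj : forall v, exists u, v = dec u)
           (dec_eq0 : forall u, dec u = 0 <-> exists c, u = c *m Theta).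
Variable A : 'M[R]_N.
Hypothesis decX : forall u, dec ('X *: u) = A *m dec u.

Lemma dec_sub1Xn j u : dec (('X - 1) ^+ j *: u) = (A - 1) ^+ j *m dec u.
Proof.
elim: j => [|j IH]; first by rewrite !expr0 scale1r mul1mx.
rewrite !exprS -scalerA scalerBl scale1r (decB decD decZ) decX IH.
by rewrite -[in RHS]mulmxA [RHS]mulmxBl mul1mx.
Qed.

Lemma dec_annihilated u : dec (('X^q - 1) *: u) = 0.
Proof.
(* This block matrix is complementary to [Theta]: their product is the scalar f g = X^q - 1. *)
apply/dec_eq0; exists (u *m block_mx g%:M 0 (ext_class R p m) f%:M).
rewrite -mulmxA /presentation mulmx_block !mulmx0 !mul0mx !addr0 add0r.
rewrite mulmxN !mul_scalar_mx !mul_mx_scalar scale_scalar_mx subrr.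
rewrite !scale_scalar_mx [g * f]mulrC fgpol // -scalar_mx_block.
by rewrite mul_mx_scalar.
Qed.

Lemma mulmx_cV_inj (B C : 'M[R]_N) : (forall v : 'cV_N, B *m v = C *m v) -> B = C.
Proof.
move=> BC; apply/matrixP=> i j.
by have /colP/(_ i) := BC (delta_mx j 0); rewrite -!colE !mxE.
Qed.

Lemma action_order : A ^+ q = 1.
Proof.
apply: mulmx_cV_inj => v; rewrite mul1mx.
have [u ->] := dec_surj v; apply/eqP; rewrite -subr_eq0; apply/eqP.
by rewrite -(dec_annihilated u) scalerBl scale1r (decB decD decZ) (decXn decX).
Qed.

(** If A^k = 1, then by Bezout A^(p^(s-1)) = 1. The generator v_0 has annihilator (f), so f would
    divide X^(p^(s-1)) - 1, against the degrees. *)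
Lemma action_faithful k : (0 < k < q)%N -> A ^+ k <> 1.
Proof.
move=> /andP[k0 kq] Ak.
have [e le_e dE] : exists2 e, (e < s)%N & gcdn k q = (p ^ e)%N.
  have /(dvdn_pfactor _ _ p_pr)[e le_e dE] := dvdn_gcdr k q; exists e => //.
  rewrite ltn_neqAle le_e andbT; apply: contraTneq kq => es.
  by rewrite -leqNgt -es -dE dvdn_leq // dvdn_gcdl.
have Ad : A ^+ (p ^ (s - 1)) = 1.
  have Ae : A ^+ (p ^ e) = 1.
    have [a b ab _] := egcdnP q k0.
    have := congr1 (fun j => A ^+ j) ab.
    by rewrite /= mulnC exprM Ak expr1n exprD mulnC exprM action_order expr1n mul1r dE => ->.
  have -> : (s - 1 = e + (s - 1 - e))%N.
    by rewrite subnKC // subn1 -ltnS prednK // (ltn_trans _ s3).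
  by rewrite expnD exprM Ae expr1n.
set D := (p ^ (s - 1))%N in Ad.
have D0 : (0 < D)%N by rewrite expn_gt0 p_gt0.
have /dec_eq0[c] : dec (('X^D - 1) *: row_mx (delta_mx 0 0) 0) = 0.
  by rewrite scalerBl scale1r (decB decD decZ) (decXn decX) Ad mul1mx subrr.
rewrite -[c]hsubmxK /presentation mul_row_block mulmx0 add0r !mul_mx_scalar.
rewrite scale_row_mx scaler0 => /eq_row_mx[+ c2g].
have -> : rsubmx c = 0.
  apply/rowP=> i; rewrite [RHS]mxE; apply: (monic_mulIr (gpol_monic R p_pr)).
  by move/rowP/(_ i): c2g; rewrite !mxE mul0r mulrC => <-.
rewrite mul0mx addr0 => /rowP/(_ 0); rewrite !mxE !eqxx mulr1 mulrC => fE.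
have nz : 'X^D - 1 != 0 :> {poly R} by rewrite monic_neq0 ?monic_Xn_sub1.
have c0 : lsubmx c 0 0 != 0.
  by apply: contraNneq nz => c0; rewrite fE !mxE in c0 *; rewrite c0 mul0r.
have := congr1 (fun h : {poly R} => size h) fE; rewrite size_Xn_sub_1 //.
rewrite size_Mmonic ?fpol_monic //; last by move: c0; rewrite mxE.
move: c0; rewrite mxE -size_poly_gt0 => c0 sz.
by have := size_fpol_gt R p_pr s3; rewrite -/D; lia.
Qed.

(** Entries of [Om] lie in (p, X - 1), so P maps into p M + (A - 1) M; and (A - 1)^q vanishes modulo
    p because (X - 1)^q and X^q - 1 agree there. *)
Lemma action_idempotent_eq0 (P : 'M[R]_N) Om : P * A = A * P -> P * P = P ->
  (forall u, P *m dec u = dec (u *m Om)) -> res Om = 0 -> P = 0.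
Proof.
move=> PA PP lift Om0; apply: (@nilpotent_idempotent _ p q _ A P separated PA PP) => v.
  have [u ->] := dec_surj v.
  have [h hE] : exists h : {poly R}, lam ^+ q - ('X^q - 1) = p%:R *: h.
    apply: (poly_reduction_ker rho_ker).
    rewrite rmorphB rmorphXn !rmorphB /= map_polyX map_polyXn rmorph1.
    by rewrite frobenius_sub1 // subrr.
  exists (dec (h *: u)); rewrite -dec_sub1Xn -[_ ^+ q](subrK ('X^q - 1)) hE.
  by rewrite scalerDl decD dec_annihilated addr0 -mul_polyC -scalerA decZ.
have [u ->] := dec_surj v.
have /choice[ab abE] (ij : 'I_(n + n) * 'I_(n + n)) :
    exists ab : {poly R} * {poly R}, Om ij.1 ij.2 = p%:R *: ab.1 + lam * ab.2.
  have [|a [b E]] := @poly_residue_ker _ _ rho rho_ker (Om ij.1 ij.2).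
    by move/matrixP/(_ ij.1 ij.2): Om0; rewrite !mxE.
  by exists (a, b).
exists (dec (u *m \matrix_(i, j) (ab (i, j)).1)), (dec (u *m \matrix_(i, j) (ab (i, j)).2)).
rewrite lift -decZ -[A - 1]expr1 -dec_sub1Xn expr1 -decD !scalemxAr -mulmxDr.
congr (dec (_ *m _)); apply/matrixP=> i j.
by rewrite !mxE (abE (i, j)) mul_polyC.
Qed.

(** The residue of a lift is block lower triangular with twice the same diagonal block, which is 0
    or 1 by [idem_comm_jordan]. For 0, the residue is an idempotent of square zero, hence 0, and so
    is P; for 1, the same applies to 1 - P. *)
Lemma action_idempotent (P : 'M[R]_N) : P * A = A * P -> P * P = P -> P = 0 \/ P = 1.
Proof.
move=> PA PP; have [Om [lift [C OmE]]] := dec_lift decD decZ dec_surj dec_eq0 decX PA.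
have [ur0 ul_dr comm] := residue_endomorphism rho p_pr s3 natreg OmE.
set Om0 := res Om in ur0 ul_dr comm.
have Om0K : Om0 *m Om0 = Om0.
  have [D DE] : exists D, Om *m Om - Om = D *m Theta.
    apply: (dec_rows dec_eq0) => i.
    rewrite linearB /= (decB decD decZ) row_mul rowE -!lift mulmxA [P *m P]PP.
    by rewrite subrr.
  apply/eqP; rewrite -subr_eq0 -map_mxM -map_mxB DE map_mxM.
  by rewrite residue_presentation ?mulmx0.
have blockE : Om0 = block_mx (ulsubmx Om0) 0 (dlsubmx Om0) (ulsubmx Om0).
  by rewrite -{1}[Om0]submxK ur0 -ul_dr.
have ulK : ulsubmx Om0 *m ulsubmx Om0 = ulsubmx Om0.
  move: Om0K; rewrite {1 2}blockE mulmx_block => /(congr1 ulsubmx).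
  by rewrite block_mxKul mul0mx addr0.
have nil0 (B : 'M['F_p]_n) (M : 'M['F_p]_(n + n)) :
    M *m M = M -> M = block_mx 0 0 B 0 -> M = 0.
  move=> MM ME; rewrite -MM ME mulmx_block !mulmx0 !mul0mx !addr0; exact: block_mx0.
have [ul0|ul1] := idem_comm_jordan ulK comm.
  left; apply: (action_idempotent_eq0 PA PP lift); apply: (nil0 (dlsubmx Om0)) => //.
  by rewrite -/Om0 {1}blockE ul0.
right; apply/esym/eqP; rewrite -subr_eq0; apply/eqP.
apply: (@action_idempotent_eq0 _ (1%:M - Om)).
- by rewrite mulrBl mulrBr mulr1 mul1r PA.
- by rewrite mulrBl mul1r mulrBr mulr1 PP subrr subr0.
- by move=> u; rewrite mulmxBl mul1mx mulmxBr mulmx1 (decB decD decZ) lift.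
apply: (nil0 (- dlsubmx Om0)).
  rewrite map_mxB map_mx1 -/Om0 mulmxBl mul1mx mulmxBr mulmx1 Om0K subrr subr0 //.
rewrite map_mxB map_mx1 -/Om0 {1}blockE ul1 scalar_mx_block opp_block_mx add_block_mx.
by rewrite !subrr add0r.
Qed.

(** Row 0 of the Jordan block is zero, so the first relation of the second kind is g e_0 = (X -
    1)^(p-1) v_0. Both sides are divisible by X - 1, and this vector is the difference of the
    quotients; X - 1 therefore kills it. *)
Definition fixed_vector : 'rV[{poly R}]_(n + n) :=
  row_mx ((- lam ^+ (p - 2)) *: delta_mx 0 0) (geom R p p *: delta_mx 0 0).

Lemma fixed_vectorP : A *m dec fixed_vector = dec fixed_vector.
Proof.
rewrite -decX; apply/(dec_eq decD decZ dec_eq0).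
exists (row_mx 0 (delta_mx 0 0)).
rewrite /fixed_vector /presentation mul_row_block mul0mx add0r mul0mx add0r.
rewrite mulmxN mul_mx_scalar /ext_class mulmxDr mul_mx_scalar -scalemxAr.
have -> : delta_mx 0 0 *m jordan n {poly R} = 0 :> 'rV_n.
  by apply/rowP=> i; rewrite -rowE !mxE.
rewrite scaler0 addr0 scale_row_mx !scalerA add_row_mx; congr row_mx.
  rewrite -scalerBl; congr (_ *: _).
  have -> : lam ^+ p.-1 = lam * lam ^+ (p - 2).
    by rewrite -exprS; congr (_ ^+ _); clear -p_gt1; lia.
  by ring.
by rewrite -scalerDl; congr (_ *: _); rewrite /gpol; ring.
Qed.

(** The e_0-coordinates are compared modulo p. The norm contributes a multiple of (X - 1)^(q - p^c),
    the relations one of g = (X - 1)^(p^2-p+1), whereas k w contributes k (X - 1)^(p^2-p). As q -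
    p^c > p^2 - p, this would force p to divide k. *)
Lemma fixed_vector_not_norm c k y : (c < s)%N -> ~~ (p %| k)%N ->
  (\sum_(i < p ^ (s - c)) A ^+ (p ^ c * k * i)) *m y <> k%:R *: dec fixed_vector.
Proof.
move=> cs pk; have [u ->] := dec_surj y => H.
have k0 : (0 < k)%N by case: k pk {H} => //; rewrite dvdn0.
have : dec (geom R (p ^ c * k) (p ^ (s - c)) *: u) = dec (k%:R%:P *: fixed_vector).
  rewrite decZ -H scaler_suml (dec_sum decD) mulmx_suml.
  by apply: eq_bigr => i _; rewrite (decXn decX).
case/(dec_eq decD decZ dec_eq0) => d.
rewrite -[d]hsubmxK /presentation mul_row_block mulmx0 add0r !mul_mx_scalar.
rewrite -{1}[u]hsubmxK !scale_row_mx add_row_mx => /eq_row_mx[_].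
move/rowP/(_ 0); rewrite !mxE !eqxx /= mulr1 => /(congr1 red).
rewrite [LHS]rmorphM rmorphD [X in _ = X + _]rmorphM [X in _ = _ + X]rmorphM /=.
rewrite red_g // red_geomp // map_geom map_polyC /= rmorph_nat.
rewrite geom_modp // subnKC ?(ltnW cs) // subrX1.
(* Here c < s and s >= 3 give q - p^c >= (p - 1) p^(s-1) >= (p - 1) p^2. *)
have [e ->] : exists e, (q - p ^ c = (p ^ 2 - p).+1 + e)%N.
  exists (q - p ^ c - (p ^ 2 - p).+1)%N; rewrite subnKC //.
  have le_c : (p ^ c <= p ^ (s - 1))%N by rewrite leq_pexp2l //; lia.
  have le2 : (p ^ 2 <= p ^ (s - 1))%N by rewrite leq_pexp2l //; lia.
  have -> : (q = p * p ^ (s - 1))%N by rewrite -expnS; congr expn; lia.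
  move: le_c le2; move: (p ^ (s - 1))%N (p ^ c)%N => t t'; rewrite -mulnn; nia.
rewrite exprMn exprD; set L := 'X - 1; set v := red _; set w := red _.
set S := \sum_(i < k) _ => H'.
have := @lamp_cancel p (p ^ 2 - p) k%:R%:P
  (L ^+ e * S ^+ ((p ^ 2 - p).+1 + e) * v - w).
rewrite hornerC => H0; move/negP: pk; apply.
rewrite (dvdn_pcharf (pchar_Fp p_pr)); apply/eqP/H0.
rewrite mulrBr -/L; apply: (canRL (addrK _)); rewrite mulrC.
by rewrite -H'; ring.
Qed.
End Lattice.

(** * Coefficient rings *)


(** This is the construction over an abstract coefficient ring. In the last clause p^c k covers
    every nonzero exponent below p^s, and the sum is the norm of the subgroup generated by that
    power. *)
Theorem unbounded_lattices_over (R : comNzRingType) (p s m : nat) (rho : {rmorphism R -> 'F_p}) :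
    prime p -> (2 < s)%N ->
    (forall x, rho x = 0 -> exists y, x = p%:R * y) ->
    (forall k (x : R), (0 < k)%N -> x *+ k = 0 -> x = 0) ->
    (forall x : R, (forall k, exists y, x = (p ^ k)%:R * y) -> x = 0) ->
  exists N, (m < N)%N /\ exists (A : 'M[R]_N) (w : 'cV[R]_N),
  [/\ A ^+ (p ^ s) = 1,
      forall k, (0 < k < p ^ s)%N -> A ^+ k <> 1,
      forall P, P * A = A * P -> P * P = P -> P = 0 \/ P = 1,
      A *m w = w &
      forall c k y, (c < s)%N -> ~~ (p %| k)%N ->
        (\sum_(i < p ^ (s - c)) A ^+ (p ^ c * k * i)) *m y <> k%:R *: w].
Proof.
move=> p_pr s3 rho_ker natreg separated.
have f_gt1 : (1 < size (fpol R p s))%N.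
  by apply: leq_ltn_trans (size_fpol_gt R p_pr s3); rewrite addn1.
have [N [dec [leN decD decZ dec_surj dec_eq0]]] := cokernel_coordinates
  (fpol_monic R s p_pr) (gpol_monic R p_pr) f_gt1 (ext_class R p m).
have [A decX] := dec_operator decD decZ dec_surj dec_eq0.
exists N; split=> //; exists A, (dec (fixed_vector R p m)); split.
- exact: (action_order s3 decD decZ dec_surj dec_eq0 decX).
- exact: (action_faithful p_pr s3 decD decZ dec_surj dec_eq0 decX).
- exact: (action_idempotent p_pr s3 rho_ker natreg separated decD decZ dec_surj dec_eq0 decX).
- exact: (fixed_vectorP p_pr decD decZ dec_eq0 decX).
- move=> c k y; exact: (fixed_vector_not_norm rho p_pr s3 decD decZ dec_surj dec_eq0 decX).
Qed.

(** * From a subset of F to a ring with residue field of p elements *)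

Definition is_subring (F : fieldType) (K : F -> Prop) : Prop :=
  [/\ K 1, forall x y, K x -> K y -> K (x - y) & forall x y, K x -> K y -> K (x * y)].

Section SubringType.
Variables (F : fieldType) (K : F -> Prop) (Ksub : is_subring K).

Definition subring_pred of is_subring K : {pred F} := fun x => `[<K x>].

Fact subring_pred_closed : subring_closed (subring_pred Ksub).
Proof.
case: (Ksub) => K1 KB KM; split; first exact/asboolP.
  by move=> x y /asboolP Kx /asboolP Ky; apply/asboolP/KB.
by move=> x y /asboolP Kx /asboolP Ky; apply/asboolP/KM.
Qed.

HB.instance Definition _ := GRing.isSubringClosed.Build F (subring_pred Ksub) subring_pred_closed.

Record subring_type := SubringElt {subring_val :> F; _ : subring_val \in subring_pred Ksub}.
HB.instance Definition _ := [isSub for subring_val].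
HB.instance Definition _ := [Choice of subring_type by <:].
HB.instance Definition _ := [SubChoice_isSubComNzRing of subring_type by <:].

Lemma subring_as_ring : exists (R : comNzRingType) (iota : {rmorphism R -> F}),
  injective iota /\ forall x, K x <-> exists r, x = iota r.
Proof.
exists subring_type, (val : {rmorphism subring_type -> F}); split; first exact: val_inj.
move=> x; split=> [Kx | [r ->]]; last by have /asboolP := valP r.
have Kx' : x \in subring_pred Ksub by apply/asboolP.
by exists (SubringElt Kx').
Qed.
End SubringType.

(** Each x is sent to the class of an integer congruent to it modulo p; [uniq] shows that the class
    is independent of the choice, whence additivity and multiplicativity. *)
Lemma residue_morphism (R : comNzRingType) (p : nat) : prime p ->
    (forall x : R, exists (z : int) y, x - z%:~R = p%:R * y) ->
    (forall (z : int) (y : R), z%:~R = p%:R * y -> (p %| z)%Z) ->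
  exists rho : {rmorphism R -> 'F_p}, forall x, rho x = 0 -> exists y, x = p%:R * y.
Proof.
move=> p_pr repr dvd_p; have [r rP] := choice repr.
have Fp_eq0 (z : int) : (z%:~R == 0 :> 'F_p) = (p %| z)%Z.
  case: z => z; first by rewrite /= dvdzE /= -(dvdn_pcharf (pchar_Fp p_pr)).
  by rewrite NegzE mulrNz oppr_eq0 dvdzE /= -(dvdn_pcharf (pchar_Fp p_pr)).
have uniq x (z : int) y : x - z%:~R = p%:R * y -> (r x)%:~R = z%:~R :> 'F_p.
  have [y' y'E] := rP x => yE; apply/eqP; rewrite -subr_eq0 -mulrzBr Fp_eq0.
  apply: (dvd_p _ (y - y')); rewrite mulrBr -yE -y'E intrB; ring.
pose rho x : 'F_p := (r x)%:~R.
have rhoB : zmod_morphism rho.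
  move=> x y; rewrite /rho -intrB; have [a aE] := rP x; have [b bE] := rP y.
  by apply: (uniq _ _ (a - b)); rewrite mulrBr -aE -bE intrB; ring.
have rhoM : monoid_morphism rho.
  split; first by rewrite /rho (uniq 1 1 0) ?mulr0 ?subrr.
  move=> x y; rewrite /rho -intrM; have [a aE] := rP x; have [b bE] := rP y.
  apply: (uniq _ _ (a * y + (r x)%:~R * b)).
  rewrite mulrDr mulrA -aE mulrCA -bE intrM; ring.
pose rA := GRing.isZmodMorphism.Build R 'F_p rho rhoB.
pose rM := GRing.isMonoidMorphism.Build R 'F_p rho rhoM.
exists (HB.pack_for {rmorphism R -> 'F_p} rho rA rM) => x /= /eqP.
rewrite Fp_eq0 => /dvdzP[z zE]; have [y yE] := rP x.
by exists (y + z%:~R); rewrite mulrDr -yE zE intrM mulrC; ring.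
Qed.


(** The common ground of the three coefficient rings: characteristic zero, residue ring Z/p, and
    p-adic separation. *)
Definition residually_prime (p : nat) (F : fieldType) (K : F -> Prop) : Prop :=
  [/\ injective (fun z : int => z%:~R : F),
      forall x, K x -> exists z : int, pmulK K p 1 (x - z%:~R),
      forall z : int, pmulK K p 1 z%:~R -> (p %| z)%Z &
      forall x, K x -> (forall k, pmulK K p k x) -> x = 0].

Lemma int_eq0_of_pexp_dvd (p : nat) (z : int) : (1 < p)%N ->
  (forall k, ((p ^ k)%N %| z)%Z) -> z = 0.
Proof.
move=> p1 dvd_z; apply/eqP; rewrite -absz_eq0; apply/negPn/negP.
rewrite -lt0n => z0; have := dvd_z `|z|%N; rewrite dvdzE /= => /(dvdn_leq z0).
by rewrite leqNgt ltn_expl.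
Qed.

Section Coefficients.
Variables (F : fieldType) (p : nat) (K : F -> Prop).
Hypothesis p_pr : prime p.
Let p_gt1 := prime_gt1 p_pr.

Lemma Z_coefficients : is_Z_in K -> is_subring K /\ residually_prime p K.
Proof.
case=> inj KE; have KZ (z : int) : K z%:~R by apply/KE; exists z.
split.
  split; first exact: (KZ 1).
    by move=> _ _ /KE[a ->] /KE[b ->]; rewrite -intrB.
  by move=> _ _ /KE[a ->] /KE[b ->]; rewrite -intrM.
have dvd k (z : int) : pmulK K p k z%:~R -> ((p ^ k)%N %| z)%Z.
  case=> _ [/KE[a ->]]; rewrite -[(_)%:R]/((p ^ k)%N%:Z%:~R) -intrM => /inj->.
  by rewrite dvdz_mulr.
split=> //.
- move=> _ /KE[z ->]; exists z, 0; split; first exact: (KZ 0).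
  by rewrite subrr mulr0.
- by move=> z /dvd; rewrite expn1.
move=> _ /KE[z ->] zK; rewrite (@int_eq0_of_pexp_dvd p z) // => k; exact: dvd.
Qed.

Lemma Zp_coefficients : is_Zp_in p K -> is_subring K /\ residually_prime p K.
Proof.
case=> Ksub repr dvd sep _; split; first exact: Ksub.
have K0 : K 0 by case: Ksub => K1 KB _; rewrite -(subrr 1); apply: KB.
(* An integer that vanishes in K lies in every p^k K, hence is divisible by every p^k. *)
have int0 (z : int) : z%:~R = 0 :> F -> z = 0.
  move=> z0; apply: (int_eq0_of_pexp_dvd p_gt1) => k; apply: dvd.
  by exists 0; rewrite mulr0.
split.
- move=> a b ab; apply/eqP; rewrite -subr_eq0; apply/eqP/int0.
  by rewrite intrB ab subrr.
- by move=> x /(repr 1%N).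
- by move=> z /dvd; rewrite expn1.
exact: sep.
Qed.

Lemma Zloc_coefficients : is_Zloc_in p K -> is_subring K /\ residually_prime p K.
Proof.
case=> inj KE.
have nz (b : int) : ~~ (p %| b)%Z -> b%:~R != 0 :> F.
  by apply: contraNneq => b0; rewrite (inj b 0) ?dvdz0.
have KP x : K x <-> exists a b : int, ~~ (p %| b)%Z /\ x = a%:~R / b%:~R.
  rewrite KE; split=> -[a [b [pb xE]]]; exists a, b; split=> //.
    by rewrite -xE mulfK // nz.
  by rewrite xE divfK // nz.
have pM (a b : int) : ~~ (p %| a)%Z -> ~~ (p %| b)%Z -> ~~ (p %| a * b)%Z.
  by rewrite !dvdzE abszM /= Euclid_dvdM // negb_or => -> ->.
have dvd k (a b : int) : ~~ (p %| b)%Z ->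
    pmulK K p k (a%:~R / b%:~R) -> ((p ^ k)%N %| a)%Z.
  move=> pb [y [/KP[c [d [pd ->]]]]].
  rewrite mulrA => /eqP; rewrite eqr_div ?nz // -[(_)%:R]/((p ^ k)%N%:Z%:~R) -!intrM.
  move=> /eqP/inj E.
  have : ((p ^ k)%N %| a * d)%Z by rewrite E -mulrA dvdz_mulr.
  rewrite !dvdzE abszM /= Gauss_dvdl // coprimeXl // prime_coprime //.
split.
  split.
  - by apply/KP; exists 1, 1; rewrite divr1 dvdzE /= dvdn1 neq_ltn p_gt1 orbT.
  - move=> _ _ /KP[a [b [pb ->]]] /KP[c [d [pd ->]]]; apply/KP.
    exists (a * d - c * b), (b * d); split; first exact: pM.
    by rewrite intrB !intrM; field; rewrite !nz.
  move=> _ _ /KP[a [b [pb ->]]] /KP[c [d [pd ->]]]; apply/KP.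
  exists (a * c), (b * d); split; first exact: pM.
  by rewrite !intrM; field; rewrite !nz.
split=> //.
- move=> _ /KP[a [b [pb ->]]].
  (* With u p + v b = 1, the fraction a / b differs from the integer a v by p (a u) / b. *)
  have /coprimezP[[u v] /= uv] : coprimez p b by rewrite coprimezE /= prime_coprime.
  exists (a * v), ((a * u)%:~R / b%:~R); split; first by apply/KP; exists (a * u), b.
  rewrite expn1 -[p%:R]/(p%:Z%:~R) mulrA -intrM; apply: (canRL (mulfK (nz _ pb))).
  rewrite mulrBl divfK ?nz // -!intrM -intrB; congr (_%:~R).
  by rewrite -{1}[a]mulr1 -uv; ring.
- move=> z; rewrite -[z%:~R]divr1 -[1]/(1%:Z%:~R) => /dvd; rewrite expn1; apply.
  by rewrite dvdzE /= dvdn1 neq_ltn p_gt1 orbT.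
move=> _ /KP[a [b [pb ->]]] aK; rewrite (@int_eq0_of_pexp_dvd p a) ?mul0r // => k.
exact: dvd pb (aK k).
Qed.

Lemma std_coefficients : std_coeff_ring p K -> is_subring K /\ residually_prime p K.
Proof.
by case=> [/Z_coefficients|[/Zloc_coefficients|/Zp_coefficients]].
Qed.
End Coefficients.

(** * Passage to F: decompositions, the cocycle and torsion *)

Section Transfer.
Variables (F : fieldType) (K : F -> Prop) (R : comNzRingType) (iota : {rmorphism R -> F}).
Hypotheses (iota_inj : injective iota) (KE : forall x, K x <-> exists r, x = iota r).

Lemma K_iota r : K (iota r).
Proof. by apply/KE; exists r. Qed.

Lemma matrix_lift a b (M : 'M[F]_(a, b)) : (forall i j, K (M i j)) ->
  exists M', M = map_mx iota M'.
Proof.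
move=> MK; have /choice[r rP] (ij : 'I_a * 'I_b) : exists r, M ij.1 ij.2 = iota r.
  exact/KE.
by exists (\matrix_(i, j) r (i, j)); apply/matrixP=> i j; rewrite !mxE -rP.
Qed.

Lemma map_mx_iota_inj a b : injective (map_mx iota : 'M[R]_(a, b) -> 'M[F]_(a, b)).
Proof.
by move=> M M' /matrixP E; apply/matrixP=> i j; have := E i j; rewrite !mxE => /iota_inj.
Qed.

Lemma map_mxX N (A : 'M[R]_N) k : map_mx iota (A ^+ k) = map_mx iota A ^+ k.
Proof.
elim: k => [|k IH]; first exact: map_mx1.
by rewrite !exprS [LHS]map_mxM IH.
Qed.

Lemma mxpowE N (A : 'M[F]_N) k : mxpow A k = A ^+ k.
Proof. by elim: k => //= k; rewrite /mxpow /= exprS => ->. Qed.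

Variables (N : nat) (A : 'M[R]_N).
Notation AF := (map_mx iota A).

(** A decomposition yields the projection onto U along V. Its columns are the U-components of the
    standard basis, so it has entries in K; it commutes with the action because U and V are
    stable. *)
Lemma indecomposable_of_idempotents : (0 < N)%N ->
  (forall P : 'M[R]_N, P * A = A * P -> P * P = P -> P = 0 \/ P = 1) ->
  indecomposable K AF.
Proof.
move=> N0 idem; split=> // U V [UK U0 UD UZ UA] [VK V0 VD VZ VA] disj dec.
have KN1 : K (-1) by apply/KE; exists (-1); rewrite rmorphN1.
have UB x y : U x -> U y -> U (x - y).
  by move=> Ux Uy; apply: UD => //; rewrite -scaleN1r; apply: UZ.
have VB x y : V x -> V y -> V (x - y).
  by move=> Vx Vy; apply: VD => //; rewrite -scaleN1r; apply: VZ.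
have /choice[u uP] (j : 'I_N) : exists u, U u /\ V (delta_mx j 0 - u).
  have [|u [w [Uu Vw E]]] := dec (delta_mx j 0).
    by move=> i k; apply/KE; rewrite mxE; exists ((i == j) && (k == 0))%:R; rewrite rmorph_nat.
  by exists u; split=> //; rewrite E addrC addKr.
pose P := \matrix_(i, j) u j i 0.
have Psum v : P *m v = \sum_j v j 0 *: u j.
  apply/colP=> i; rewrite mxE summxE; apply: eq_bigr => j _.
  by rewrite !mxE mulrC.
have PU v : in_latt K v -> U (P *m v).
  by move=> vK; rewrite Psum; elim/big_ind: _ => // j _; apply: UZ => //; case: (uP j).
have PV v : in_latt K v -> V (v - P *m v).
  move=> vK; rewrite Psum {1}[v]matrix_sum_delta -sumrB.
  elim/big_ind: _ => // j _; rewrite big_ord1 -scalerBr.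
  by apply: VZ => //; case: (uP j).
have PE v x y : U x -> V y -> v = x + y -> P *m v = x.
  move=> Ux Vy vE.
  have vK : in_latt K v.
    move=> i j; rewrite vE mxE; have /KE[a ->] := UK _ Ux i j; have /KE[b ->] := VK _ Vy i j.
    by rewrite -rmorphD; exact: K_iota.
  apply/eqP; rewrite -subr_eq0; apply/eqP/disj; first by apply: UB => //; exact: PU.
  have -> : P *m v - x = y - (v - P *m v).
    by rewrite opprB addrCA; congr (_ + _); rewrite vE opprD addrCA subrr addr0.
  by apply: VB => //; exact: PV.
have PU_id x : U x -> P *m x = x by move=> Ux; apply: (PE _ _ 0); rewrite ?addr0.
have PV_0 y : V y -> P *m y = 0 by move=> Vy; apply: (PE _ _ y); rewrite ?add0r.
have [P' P'E] : exists P', P = map_mx iota P'.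
  by apply: matrix_lift => i j; rewrite mxE; case: (uP j) => Uu _; exact: UK.
have ext (B C : 'M[F]_N) : (forall j, B *m delta_mx j (0 : 'I_1) = C *m delta_mx j 0) -> B = C.
  move=> E; apply/matrixP=> i j.
  by have /colP/(_ i) := E j; rewrite -!colE !mxE.
have uE j : P *m delta_mx j (0 : 'I_1) = u j.
  have [Uu Vw] := uP j; apply: (PE _ _ _ Uu Vw); by rewrite addrC subrK.
have [||P0|P1] := idem P'.
- apply: map_mx_iota_inj; rewrite !map_mxM -P'E; apply: ext => j.
  have [Uu Vw] := uP j; rewrite -!mulmxA uE.
  apply: (PE _ _ (AF *m (delta_mx j 0 - u j))); [exact: UA|exact: VA|].
  by rewrite -mulmxDr addrC subrK.
- apply: map_mx_iota_inj; rewrite map_mxM -P'E; apply: ext => j.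
  by rewrite -mulmxA uE; apply: PU_id; case: (uP j).
- by left=> x /PU_id; rewrite P'E P0 map_mx0 mul0mx.
by right=> y /PV_0; rewrite P'E P1 map_mx1 mul1mx.
Qed.

Variables (p s : nat) (w : 'cV[R]_N).
Hypotheses (p_pr : prime p) (natF : forall k, (k%:R == 0 :> F) = (k == 0%N)).
Hypotheses (Aq : A ^+ (p ^ s) = 1) (Aw : A *m w = w).
Notation q := (p ^ s)%N.
Notation wF := (map_mx iota w).

Definition averaged_cocycle (k : nat) : 'cV[F]_N := (k%:R / q%:R) *: wF.

Lemma q_neq0 : q%:R != 0 :> F.
Proof. by rewrite natF -lt0n expn_gt0 prime_gt0. Qed.

Lemma AFXw k : AF ^+ k *m wF = wF.
Proof.
elim: k => [|k IH]; first exact: mul1mx.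
by rewrite exprS -mulmxA IH -map_mxM Aw.
Qed.

Lemma averaged_cocycleP : cocycle K q AF averaged_cocycle.
Proof.
move=> k l _ _ i j; rewrite mxpowE /averaged_cocycle -scalemxAr AFXw -scalerDl -mulrDl.
(* Wrapping around modulo q changes the value by an integral multiple of w, which lies in the
   lattice. *)
have -> : ((k + l) %% q)%N%:R = (l%:R + k%:R) - ((k + l) %/ q)%N%:R * q%:R :> F.
  by rewrite -natrD addnC {2}(divn_eq (l + k) q) natrD natrM addrC addKr.
rewrite mulrBl mulfK ?q_neq0 // scalerBl addrAC subrr sub0r !mxE.
by rewrite -(rmorph_nat iota) -rmorphM -rmorphN; exact: K_iota.
Qed.

Lemma crys_powE (e : nat * 'cV[F]_N) r :
  crys_pow q AF e r = ((e.1 * r) %% q, (\sum_(i < r) AF ^+ (e.1 * i)) *m e.2)%N.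
Proof.
elim: r => [|r IH]; first by rewrite /crys_pow /= muln0 mod0n big_ord0 mul0mx.
rewrite /crys_pow iterS -/(crys_pow q AF e r) IH /crys_mul /= modnDml mulnS addnC.
congr pair; rewrite mxpowE big_ord_recl muln0 mulmxDl mul1mx [RHS]addrC mulmxA.
congr (_ *m _ + _); rewrite mulmx_sumr; apply: eq_bigr => i _.
by rewrite /= /bump add1n mulnS exprD.
Qed.

Hypothesis not_norm : forall c k y, (c < s)%N -> ~~ (p %| k)%N ->
  (\sum_(i < p ^ (s - c)) A ^+ (p ^ c * k * i)) *m y <> k%:R *: w.

(** Let k = p^c k' with k' prime to p, so that a^k has order d = p^(s-c), and let S be its norm. If
    (a^k, x) has finite order then S x = 0. Writing x = (k/q) w + y with y in the lattice gives S
    (-y) = (k d/q) w = k' w, which [not_norm] forbids. *)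
Lemma averaged_cocycle_torsion_free : crys_torsion_free K q AF averaged_cocycle.
Proof.
move=> [k x] [/= kq xT] r r0; rewrite crys_powE //= => -[/eqP q_kr].
have [k0|k_gt0] := posnP k.
  (* For k = 0 the element is a translation, and r x = 0 forces x = 0 in characteristic zero. *)
  rewrite k0 (eq_bigr (fun=> 1)) => [|i _]; last by rewrite mul0n.
  rewrite sumr_const card_ord -scaler_nat -scalemxAl mul1mx => /eqP.
  by rewrite scaler_eq0 natF -leqn0 leqNgt r0 /= => /eqP->.
have [k' pk' kE] := pfactor_coprime p_pr k_gt0.
move: (logn p k) kE => c kE.
have pk : ~~ (p %| k')%N by rewrite -prime_coprime.
have k'0 : (0 < k')%N by case: (k') pk; rewrite ?dvdn0.
have cs : (c < s)%N.
  rewrite -(ltn_exp2l _ _ (prime_gt1 p_pr)); apply: leq_ltn_trans kq.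
  by rewrite kE leq_pmull.
set d := (p ^ (s - c))%N; have kd : (k * d = q * k')%N.
  by rewrite kE -mulnA -expnD subnKC ?(ltnW cs) // mulnC.
have /dvdnP[r' rE] : (d %| r)%N.
  move: q_kr; rewrite -/(dvdn q (k * r)) kE -(subnKC (ltnW cs)) expnD.
  rewrite -mulnA mulnCA dvdn_pmul2l ?expn_gt0 ?prime_gt0 // Gauss_dvdr //.
  by rewrite coprimeXl.
have r'0 : (0 < r')%N by case: (r') rE r0 => // ->.
set S := \sum_(i < d) AF ^+ (k * i).
(* The powers of A^k have period d, so the sum over r = r' d terms is r' copies of the norm. *)
have -> : \sum_(i < r) AF ^+ (k * i) = S *+ r'.
  rewrite rE; elim: (r') => [|t IH]; first by rewrite mul0n big_ord0.
  rewrite mulSn big_split_ord /= mulrS; congr (_ + _); rewrite -IH.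
  apply: eq_bigr => i _; rewrite mulnDr exprD kd [_ ^+ (q * _)]exprM -[_ ^+ q]map_mxX Aq.
  by rewrite [map_mx _ 1]map_mx1 expr1n mul1r.
rewrite -scaler_nat -scalemxAl => /eqP; rewrite scaler_eq0 natF.
rewrite -leqn0 leqNgt r'0 /= => /eqP Sx.
have [y yE] := matrix_lift xT.
case: (@not_norm c k' (- y) cs pk); apply: map_mx_iota_inj.
rewrite map_mxM map_mxN -yE map_mxZ rmorph_nat.
have -> : map_mx iota (\sum_(i < d) A ^+ (p ^ c * k' * i)) = S.
  rewrite raddf_sum; apply: eq_bigr => i _; rewrite /= map_mxX kE [(k' * _)%N]mulnC //.
rewrite opprB mulmxBr Sx subr0 /averaged_cocycle -scalemxAr.
have -> : S *m wF = d%:R *: wF.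
  rewrite mulmx_suml (eq_bigr (fun=> wF)) => [|i _]; last exact: AFXw.
  by rewrite sumr_const card_ord scaler_nat.
rewrite scalerA mulrAC -natrM kd natrM [q%:R * _]mulrC mulfK ?q_neq0 //.
Qed.
End Transfer.

Theorem theorem1 (p s : nat) (F : fieldType) (K : F -> Prop) :
  prime p -> (3 <= s)%N -> std_coeff_ring p K ->
  forall N : nat, exists n : nat, (N <= n)%N /\
    exists A : 'M[F]_n,
      [/\ KG_lattice K (p ^ s) A, faithful (p ^ s) A, indecomposable K A &
          exists T : nat -> 'cV[F]_n,
            cocycle K (p ^ s) A T /\ crys_torsion_free K (p ^ s) A T].
Proof.
move=> p_pr s3 /(std_coefficients p_pr)[Ksub [intr_inj repr dvd sep]] N.
have [R [iota [iota_inj KE]]] := subring_as_ring Ksub.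
have natF k : (k%:R == 0 :> F) = (k == 0%N).
  by apply/eqP/eqP=> [|->//]; rewrite -[k%:R]/(k%:Z%:~R) -[0]/(0%:Z%:~R) => /intr_inj[].
have pmulE k x : pmulK K p k (iota x) <-> exists y, x = (p ^ k)%:R * y.
  split=> [[_ [/KE[y ->]]] | [y ->]].
    by rewrite -(rmorph_nat iota) -rmorphM => /iota_inj->; exists y.
  by exists (iota y); split; [apply/KE; exists y | rewrite rmorphM rmorph_nat].
have [||rho rho_ker] := @residue_morphism R p p_pr.
- move=> x; have /repr[z] : K (iota x) by apply/KE; exists x.
  rewrite -(rmorph_int iota) -rmorphB => /pmulE[y yE].
  by exists z, y; rewrite yE expn1.
- by move=> z y zE; apply: dvd; rewrite -(rmorph_int iota); apply/pmulE; exists y; rewrite expn1.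
have natR k (x : R) : (0 < k)%N -> x *+ k = 0 -> x = 0.
  move=> k0 /(congr1 iota); rewrite rmorphMn rmorph0 -mulr_natl => /eqP.
  rewrite mulf_eq0 natF -leqn0 leqNgt k0 /= => /eqP.
  by rewrite -(rmorph0 iota) => /iota_inj.
have sepR (x : R) : (forall k, exists y, x = (p ^ k)%:R * y) -> x = 0.
  move=> xk; apply: iota_inj; rewrite rmorph0; apply: sep; first by apply/KE; exists x.
  by move=> k; apply/pmulE.
have [n [Nn [A [w [Aq Afaith Aidem Aw nn]]]]] :=
  @unbounded_lattices_over R p s N rho p_pr s3 rho_ker natR sepR.
exists n; split; first exact: ltnW.
exists (map_mx iota A); split.
- split; first by move=> i j; rewrite mxE; apply/KE; exists (A i j).
  by rewrite mxpowE -map_mxX Aq map_mx1.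
- move=> k /Afaith; rewrite mxpowE -map_mxX -(map_mx1 iota) => + E; apply.
  exact: map_mx_iota_inj E.
- by apply: indecomposable_of_idempotents => //; apply: leq_ltn_trans Nn.
exists (averaged_cocycle iota p s w); split.
  exact: averaged_cocycleP.
exact: averaged_cocycle_torsion_free.
Qed.
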